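(* Let $\mathcal{M}$ be a finite-dimensional $\mathbb{Z}$-graded manifold and let $\nabla$ be a connection on $T_{\mathcal{M}}$. The formal exponential map associated to $\nabla$ is well-defined; that is, there exists a unique morphism of left $C^\infty(\mathcal{M})$-modules $\mathrm{pbw}:\Gamma(S(T_{\mathcal{M}}))\to\mathcal{D}(\mathcal{M})$ such that $\mathrm{pbw}(f)=f$ for all $f\in C^\infty(\mathcal{M})$, $\mathrm{pbw}(X)=X$ for all $X\in\Gamma(T_{\mathcal{M}})$, and, for all integers $n\geqslant 1$ and all homogeneous $X_0,\dots,X_n\in\Gamma(T_{\mathcal{M}})$, $$\mathrm{pbw}(X_0\odot\cdots\odot X_n)=\frac{1}{n+1}\sum_{k=0}^n\epsilon_k\Big\{X_k\cdot\mathrm{pbw}(X^{\{k\}})-\mathrm{pbw}\big(\nabla_{X_k}(X^{\{k\}})\big)\Big\},$$ where $\epsilon_k=(-1)^{|X_k|(|X_0|+\cdots+|X_{k-1}|)}$ and $X^{\{k\}}=X_0\odot\cdots\odot X_{k-1}\odot X_{k+1}\odot\cdots\odot X_n$.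
   Context: $\Bbbk$ is $\mathbb{R}$ or $\mathbb{C}$; $|\cdot|$ denotes degree. A $\mathbb{Z}$-graded manifold $\mathcal{M}$ is a smooth manifold $M$ (the support) with a sheaf $\mathcal{O}_{\mathcal{M}}$ of $\mathbb{Z}$-graded, graded-commutative algebras over $M$ such that every point of $M$ has an open neighborhood $U$ with $\mathcal{O}_{\mathcal{M}}(U)\cong C^\infty(U)\otimes\hat{S}(V^\vee)$, for a fixed $\mathbb{Z}$-graded vector space $V$, where $\hat S(V^\vee)$ denotes the formal power series on $V$; it is finite-dimensional if $\dim M$ and $\dim V$ are finite. $C^\infty(\mathcal{M})=\mathcal{O}_{\mathcal{M}}(M)$. $\Gamma(T_{\mathcal{M}})$ is the $C^\infty(\mathcal M)$-module of vector fields (graded derivations of functions). A connection on $T_{\mathcal{M}}$ is a degree $0$ $\Bbbk$-linear map $\nabla:\Gamma(T_{\mathcal{M}})\otimes\Gamma(T_{\mathcal{M}})\to\Gamma(T_{\mathcal{M}})$ with $\nabla_{fX}Y=f\nabla_XY$ and $\nabla_X(fY)=X(f)Y+(-1)^{|X||f|}f\nabla_XY$. $S(T_{\mathcal{M}})$ is the graded symmetric algebra bundle with product $\odot$, and $\Gamma(S(T_{\mathcal{M}}))=\bigoplus_{n\geqslant0}\Gamma(S^n(T_{\mathcal{M}}))$. The connection is extended to $\Gamma(S(T_{\mathcal{M}}))$ by $\nabla_Xf=X(f)$ and $\nabla_X(X_0\odot\cdots\odot X_n)=\sum_{k=0}^n(-1)^{|X|(|X_0|+\cdots+|X_{k-1}|)}X_0\odot\cdots\odot\nabla_XX_k\odot\cdots\odot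 X_n$. $\mathcal{D}(\mathcal{M})$ is the associative algebra of differential operators on $\mathcal{M}$, with product $\cdot$ given by composition; it contains $C^\infty(\mathcal{M})$ and $\Gamma(T_{\mathcal{M}})$ and is a left $C^\infty(\mathcal{M})$-module by left multiplication. *)

(* Defs.v *)
From HB Require Import structures.
From mathcomp Require Import all_boot all_order all_algebra zify.
From mathcomp Require Import complex generic_quotient.
From mathcomp Require Import all_classical all_reals all_analysis.
Set Implicit Arguments.
Unset Strict Implicit.
Unset Printing Implicit Defensive.
Import Order.TTheory GRing.Theory Num.Theory.
Import numFieldNormedType.Exports.
Local Open Scope classical_set_scope.
Local Open Scope ring_scope.
Local Open Scope quotient_scope.

Definition sgn (A : pzRingType) (d : int) : A := (-1) ^+ `|d|%N.

(* finite sums of elements of the [H d] *)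
Inductive graded_span (V : zmodType) (H : int -> set V) : set V :=
| span_nil : graded_span H 0
| span_cons d x y : H d x -> graded_span H y -> graded_span H (x + y).

(* a direct sum decomposition of [V] into subgroups indexed by the integers *)
Record grading (V : zmodType) := Grading {
  homog :> int -> set V;
  homog0 : forall d, homog d 0;
  homogB : forall d x y, homog d x -> homog d y -> homog d (x - y);
  homog_span : forall x, graded_span homog x;
  homog_indep : forall (s : seq int) (c : int -> V),
    uniq s -> (forall d, homog d (c d)) -> \sum_(d <- s) c d = 0 ->
    forall d, d \in s -> c d = 0 }.

(* The K-algebra structure is the unit map [scal]: MathComp's [algType] excludes
   the zero ring, which is the value of a sheaf of algebras on the empty set.
   That [scal c] is central follows from [gr_comm] and [gr_scal]. *)
Record galg (K : fieldType) := GAlg {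
  galg_ring :> pzRingType;
  gr : grading galg_ring;
  scal : {rmorphism K -> galg_ring};
  gr_scal : forall c, gr 0 (scal c);
  gr_mul : forall d e a b, gr d a -> gr e b -> gr (d + e) (a * b);
  gr_comm : forall d e a b,
    gr d a -> gr e b -> a * b = sgn galg_ring (d * e) * (b * a) }.

Section GradedOperators.
Variables (K : fieldType) (A : galg K).

Definition klinear (P : A -> A) : Prop :=
  (forall a b, P (a + b) = P a + P b) /\
  (forall c a, P (scal A c * a) = scal A c * P a).

Definition of_degree (d : int) (P : A -> A) : Prop :=
  forall e a, gr A e a -> gr A (d + e) (P a).

Definition derivation (d : int) : set (A -> A^o) :=
  [set X | [/\ klinear X, of_degree d X &
     forall e f g, gr A e f -> X (f * g) = X f * g + sgn A (d * e) * (f * X g)]].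

(* [diffop_lt n d]: homogeneous differential operators of degree [d] and of
   order strictly less than [n], by iterated graded commutators with functions *)
Fixpoint diffop_lt (n : nat) (d : int) (P : A -> A) : Prop :=
  if n is m.+1 then
    [/\ klinear P, of_degree d P & forall e f, gr A e f ->
       diffop_lt m (d + e) (fun g => P (f * g) - sgn A (d * e) * (f * P g))]
  else forall a, P a = 0.

Definition diffop_homog (d : int) : set (A -> A^o) :=
  [set P | exists n, diffop_lt n d P].

Lemma sgnD d e : sgn A (d + e) = sgn A d * sgn A e.
Proof.
rewrite /sgn -exprD -signr_odd -[RHS]signr_odd; congr (_ ^+ _); congr nat_of_bool.
by case: d e => [m|m] [n|n]; lia.
Qed.

Lemma sgnC d (a : A) : a * sgn A d = sgn A d * a.
Proof. by rewrite /sgn; apply: commr_sign. Qed.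

Lemma sgnK d : sgn A d * sgn A d = 1.
Proof. by rewrite /sgn -expr2 sqrr_sign. Qed.

Lemma gr0 d : gr A d 0. Proof. exact: homog0. Qed.

Lemma grN d a : gr A d a -> gr A d (- a).
Proof. by move=> h; rewrite -sub0r; apply: homogB => //; apply: gr0. Qed.

Lemma grD d a b : gr A d a -> gr A d b -> gr A d (a + b).
Proof. by move=> h h'; rewrite -[b]opprK; apply: homogB => //; apply: grN. Qed.

Lemma gr_sgn d n a : gr A d a -> gr A d (sgn A n * a).
Proof.
by move=> h; rewrite /sgn -signr_odd; case: odd; rewrite ?expr1 ?mulN1r ?mul1r//; apply: grN.
Qed.

Lemma gr_spanP (P : A -> Prop) : P 0 ->
  (forall d a b, gr A d a -> P b -> P (a + b)) -> forall a, P a.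
Proof.
move=> P0 PD a; elim: (homog_span (gr A) a) => [|d x y hx _ IH] //.
exact: PD hx IH.
Qed.

Lemma scalC c (a : A) : a * scal A c = scal A c * a.
Proof.
elim/gr_spanP: a => [|d a b ha IH]; first by rewrite mul0r mulr0.
by rewrite mulrDl mulrDr IH (gr_comm ha (gr_scal A c)) mulr0 /sgn expr0 mul1r.
Qed.

Section Span.
Variable (H : int -> set (A -> A^o)).

Lemma span1 d X : H d X -> graded_span H X.
Proof. by move=> h; rewrite -[X]addr0; apply: span_cons h (span_nil _). Qed.

Lemma spanD X Y : graded_span H X -> graded_span H Y -> graded_span H (X + Y).
Proof.
move=> hX hY; elim: hX => [|d x y hx _ IH]; first by rewrite add0r.
by rewrite -addrA; apply: span_cons hx IH.
Qed.

Hypothesis HZ : forall d e f X, gr A e f -> H d X -> H (e + d) (f *: X).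

Lemma spanZ (f : A) X : graded_span H X -> graded_span H (f *: X).
Proof.
elim/gr_spanP: f => [|e f g hf IH] hX; first by rewrite scale0r; apply: span_nil.
rewrite scalerDl; apply: spanD; last exact: IH.
elim: hX => [|d x y hx _ IH']; first by rewrite scaler0; apply: span_nil.
by rewrite scalerDr; apply: span_cons (HZ hf hx) IH'.
Qed.

Definition spanb : {pred A -> A^o} := fun X => `[< graded_span H X >].

Lemma spanb_submod : submod_closed spanb.
Proof.
split; first by apply/asboolP; apply: span_nil.
move=> f X Y /asboolP hX /asboolP hY; apply/asboolP.
by apply: spanD => //; apply: spanZ.
Qed.
End Span.

Lemma klinearZ f P : klinear P -> klinear (fun a => f * P a).
Proof.
move=> [PD PZ]; split=> [a b|c a]; first by rewrite PD mulrDr.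
by rewrite PZ mulrA scalC -mulrA.
Qed.

Lemma of_degreeZ d e f P : gr A e f -> of_degree d P ->
  of_degree (e + d) (fun a => f * P a).
Proof. by move=> hf hP i a ha; rewrite -addrA; apply: gr_mul => //; apply: hP. Qed.

Lemma derivationZ d e (f : A) X :
  gr A e f -> derivation d X -> derivation (e + d) (f *: X).
Proof.
move=> hf [Xl Xd XL]; split; [exact (klinearZ f Xl) | exact (of_degreeZ hf Xd) |].
move=> i g h hg; have E := XL _ _ h hg; move: E; set Y : A -> A := X => E.
change (f * Y (g * h) = f * Y g * h + sgn A ((e + d) * i) * (g * (f * Y h))).
rewrite E mulrDr mulrA; congr (_ + _).
rewrite addrC mulrDl sgnD [f * (_ * _)]mulrA sgnC -!mulrA; congr (_ * _).
by rewrite !mulrA (gr_comm hf hg) -!mulrA.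
Qed.

Lemma diffop_lt0 n d P : (forall a, P a = 0) -> diffop_lt n d P.
Proof.
elim: n d P => [//|n IH] d P P0; split.
- by split=> *; rewrite !P0 ?addr0 ?mulr0.
- by move=> e a _; rewrite P0; apply: gr0.
by move=> e f _; apply: IH => a; rewrite !P0 !mulr0 subr0.
Qed.

Lemma diffop_ltS n d P : diffop_lt n d P -> diffop_lt n.+1 d P.
Proof.
elim: n d P => [|n IH] d P; first by move=> P0; apply: diffop_lt0.
by move=> [Pl Pd PC]; split=> // e f hf; apply: IH; apply: PC.
Qed.

Lemma diffop_lt_leq m n d P : (m <= n)%N -> diffop_lt m d P -> diffop_lt n d P.
Proof.
move=> le_mn hP; rewrite -(subnKC le_mn).
by elim: (n - m)%N => [|k IH]; rewrite ?addn0 ?addnS//; apply: diffop_ltS.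
Qed.

Lemma diffop_lt_klinear n d P : diffop_lt n d P -> klinear P.
Proof.
case: n => [P0|n []//]; split=> *; rewrite !P0 ?addr0 ?mulr0//.
Qed.

Lemma klinear0 (P : A -> A) : (forall a b, P (a + b) = P a + P b) -> P 0 = 0.
Proof.
move=> PD; have := PD 0 0; rewrite addr0.
by move/eqP; rewrite -subr_eq0 opprD addNKr oppr_eq0 => /eqP.
Qed.

Lemma diffop_lt_degree n d P : diffop_lt n d P -> of_degree d P.
Proof. by case: n => [P0|n []//] e a _; rewrite P0; apply: gr0. Qed.

Lemma diffop_lt_ext n d P Q : P =1 Q -> diffop_lt n d P -> diffop_lt n d Q.
Proof. by move=> /funext ->. Qed.

Lemma diffop_ltD n d P Q : diffop_lt n d P -> diffop_lt n d Q ->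
  diffop_lt n d (fun a => P a + Q a).
Proof.
elim: n d P Q => [|n IH] d P Q; first by move=> P0 Q0 a; rewrite P0 Q0 addr0.
move=> [[PD PZ] Pd PC] [[QD QZ] Qd QC]; split.
- by split=> [a b|c a]; [rewrite PD QD addrACA | rewrite PZ QZ mulrDr].
- by move=> e a ha; apply: grD; [apply: Pd | apply: Qd].
move=> e f hf; apply: diffop_lt_ext (IH _ _ _ (PC _ _ hf) (QC _ _ hf)) => a /=.
by rewrite !mulrDr opprD addrACA.
Qed.

Lemma diffop_ltMsgn n d k P : diffop_lt n d P -> diffop_lt n d (fun a => sgn A k * P a).
Proof.
elim: n d P => [|n IH] d P; first by move=> P0 a; rewrite P0 mulr0.
move=> [Pl Pd PC]; split; [exact: klinearZ | by move=> e a ha; apply/gr_sgn/Pd |].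
move=> e f hf; apply: diffop_lt_ext (IH _ _ (PC _ _ hf)) => a /=.
by rewrite mulrBr; congr (_ - _); rewrite !mulrA sgnC; congr (_ * _); rewrite -!mulrA sgnC.
Qed.

Lemma diffop_ltM m n d e P Q : diffop_lt m d P -> diffop_lt n e Q ->
  diffop_lt (m + n) (d + e) (P \o Q).
Proof.
move Ek : (m + n)%N => k; elim: k => [|k IH] in m n Ek d e P Q *.
  by case: m n Ek => [|//] [|//] _ P0 _ a /=; rewrite P0.
case: m Ek => [|m] Ek; first by move=> P0 _; apply: diffop_lt0 => a /=; rewrite P0.
case: n Ek => [|n] Ek hP hQ.
  apply: diffop_lt0 => a /=; rewrite hQ.
  exact: klinear0 (diffop_lt_klinear hP).1.
have [[PD PZ] Pd PC] := hP; have [[QD QZ] Qd QC] := hQ; split.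
- by split=> [a b|c a] /=; [rewrite QD PD | rewrite QZ PZ].
- by move=> i a ha; rewrite -addrA; apply: Pd; apply: Qd.
move=> i f hf.
have hPQ : diffop_lt k (d + (e + i)) (P \o (fun g => Q (f * g) - sgn A (e * i) * (f * Q g))).
  by apply: (IH m.+1 n) => //; [lia | apply: QC].
have hPQ' : diffop_lt k ((d + i) + e) ((fun g => P (f * g) - sgn A (d * i) * (f * P g)) \o Q).
  by apply: (IH m n.+1) => //; [lia | apply: PC].
have Edeg : (d + i) + e = d + e + i by rewrite addrAC.
rewrite Edeg in hPQ'; rewrite addrA in hPQ.
apply: diffop_lt_ext (diffop_ltD hPQ (diffop_ltMsgn (e * i) hPQ')) => g /=.
have PN a : P (- a) = - P a by apply/eqP; rewrite -addr_eq0 -PD addNr klinear0.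
have PS j a : P (sgn A j * a) = sgn A j * P a.
  by rewrite /sgn -signr_odd; case: odd; rewrite ?expr1 ?mulN1r ?mul1r.
rewrite PD PN PS mulrBr addrA subrK mulrA -sgnD.
by rewrite [(d + e) * i]mulrDl [d * i + e * i]addrC.
Qed.

Lemma diffop_mulf e f : gr A e f -> diffop_lt 1 e (fun a => f * a).
Proof.
move=> hf; split=> [|d a ha|d g hg a].
- by split=> [a b|c a]; rewrite ?mulrDr// mulrA scalC mulrA.
- exact: gr_mul.
by rewrite !mulrA (gr_comm hf hg) !mulrA subrr.
Qed.

Lemma diffop_derivation d X : derivation d X -> diffop_lt 2 d X.
Proof.
move=> [Xl Xd XL]; split=> // e f hf.
apply: (diffop_lt_ext _ (diffop_mulf (Xd _ _ hf))) => a.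
by rewrite (XL _ _ _ hf) addrK.
Qed.

Lemma diffop_homogZ d e (f : A) P :
  gr A e f -> diffop_homog d P -> diffop_homog (e + d) (f *: P).
Proof.
move=> hf [n hP]; exists (1 + n)%N.
exact: (diffop_ltM (diffop_mulf hf) hP).
Qed.

End GradedOperators.

Section VectorFields.
Variables (K : fieldType) (A : galg K).

Definition vfield_pred : {pred A -> A^o} := spanb (@derivation K A).

HB.instance Definition _ :=
  GRing.isSubmodClosed.Build A (A -> A^o) vfield_pred
    (spanb_submod (@derivationZ K A)).

Record vfield := VField { vfun :> A -> A^o; _ : vfun \in vfield_pred }.

HB.instance Definition _ := [isSub for vfun].
HB.instance Definition _ := [Choice of vfield by <:].
HB.instance Definition _ := [SubChoice_isSubLmodule of vfield by <:].

Definition vdeg (d : int) (X : vfield) : Prop := derivation d X.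

End VectorFields.

Section DifferentialOperators.
Variables (K : fieldType) (A : galg K).

Definition diffop_pred : {pred A -> A^o} := spanb (@diffop_homog K A).

HB.instance Definition _ :=
  GRing.isSubmodClosed.Build A (A -> A^o) diffop_pred
    (spanb_submod (@diffop_homogZ K A)).

Record diffop := DiffOp { dfun :> A -> A^o; _ : dfun \in diffop_pred }.

HB.instance Definition _ := [isSub for dfun].
HB.instance Definition _ := [Choice of diffop by <:].
HB.instance Definition _ := [SubChoice_isSubLmodule of diffop by <:].

Lemma diffop_klinear (P : diffop) : klinear P.
Proof.
case: P => P /asboolP /=; elim=> [|d X Y [n hX] _ [YD YZ]].
  by split=> *; rewrite ?addr0 ?mulr0.
have [XD XZ] := diffop_lt_klinear hX.
split=> [a b|c a].
  by change (X (a + b) + Y (a + b) = X a + Y a + (X b + Y b)); rewrite XD YD addrACA.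
by change (X (scal A c * a) + Y (scal A c * a) = scal A c * (X a + Y a));
  rewrite XZ YZ mulrDr.
Qed.

Lemma diffop_comp_subproof (P Q : diffop) : (P \o Q : A -> A^o) \in diffop_pred.
Proof.
have PD := (diffop_klinear P).1; case: Q => Q /asboolP /=.
elim=> [|d X Y [n hX] _ /asboolP IH].
  suff -> : (P \o (0 : A -> A^o)) = 0 :> (A -> A^o) by apply: rpred0.
  apply: (@funext A A) => a; change ((P : A -> A) 0 = 0); exact: (klinear0 PD).
suff -> : (P \o (X + Y)) = (P \o X) + (P \o Y) :> (A -> A^o).
  apply: rpredD; last exact/asboolP.
  apply/asboolP.
  case: {PD IH} P => P /asboolP /=; elim=> [|e Z W [m hZ] _ IH]; first exact: span_nil.
  by apply: (span_cons (d := e + d) (x := Z \o X) (y := W \o X)) => //;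
    exists (m + n)%N; apply: diffop_ltM.
by apply: (@funext A A) => a; exact: PD.
Qed.

Definition diffop_comp (P Q : diffop) : diffop := DiffOp (diffop_comp_subproof P Q).

Lemma diffop_fun_subproof (f : A) : (fun a => f * a : A^o) \in diffop_pred.
Proof.
apply/asboolP; elim/gr_spanP: f => [|d f g hf IH].
  suff -> : (fun a : A => 0 * a : A^o) = 0 by apply: span_nil.
  by apply: (@funext A A) => a; apply: mul0r.
suff -> : (fun a : A => (f + g) * a : A^o) = (fun a => f * a) + (fun a => g * a).
  by apply: span_cons IH; exists 1%N; apply: diffop_mulf hf.
by apply: (@funext A A) => a; apply: mulrDl.
Qed.

Definition diffop_fun (f : A) : diffop := DiffOp (diffop_fun_subproof f).

Lemma diffop_vfield_subproof (X : vfield A) : (X : A -> A^o) \in diffop_pred.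
Proof.
case: X => X /asboolP /=; elim=> [|d x y hx _ /asboolP IH].
  by apply/asboolP/span_nil.
apply/asboolP; apply: (span_cons (d := d)) => //.
by exists 2%N; apply: diffop_derivation.
Qed.

Definition diffop_vfield (X : vfield A) : diffop := DiffOp (diffop_vfield_subproof X).

Lemma diffop_compA : associative diffop_comp.
Proof. by move=> P Q S; apply: val_inj. Qed.
Lemma diffop_comp1l : left_id (diffop_fun 1) diffop_comp.
Proof. by move=> P; apply: val_inj; apply: (@funext A A) => a; apply: mul1r. Qed.
Lemma diffop_comp1r : right_id (diffop_fun 1) diffop_comp.
Proof. by move=> P; apply: val_inj; apply: (@funext A A) => a /=; rewrite mul1r. Qed.
Lemma diffop_compDl : left_distributive diffop_comp +%R.
Proof. by move=> P Q S; apply: val_inj. Qed.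
Lemma diffop_compDr : right_distributive diffop_comp +%R.
Proof.
by move=> P Q S; apply: val_inj; apply: (@funext A A) => a; apply: (diffop_klinear P).1.
Qed.

HB.instance Definition _ := GRing.Zmodule_isPzRing.Build diffop
  diffop_compA diffop_comp1l diffop_comp1r diffop_compDl diffop_compDr.

End DifferentialOperators.

Section SymmetricAlgebra.
Variables (K : fieldType) (A : galg K).
Let E := vfield A.

Fixpoint word_deg (d : int) (w : seq E) : Prop :=
  if w is X :: v then exists2 e, vdeg e X & word_deg (d - e) v else d = 0.

(* The symmetric algebra of [E] over [A], as a quotient of the free left [A]-module
   on words in [E]; words of length n give its n-th symmetric power. When [A] is the
   algebra of functions of a graded manifold and [E] its module of vector fields, this
   is the module of sections of the bundle S(T): taking sections turns tensor products
   of bundles into tensor products over [A].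
   Here [:: (f_1, w_1); ...] stands for the sum of the f_i . (product of w_i) *)
Definition sterm := seq (A * seq E).

Definition sterm_scale (f : A) (s : sterm) : sterm := [seq (f * p.1, p.2) | p <- s].

Inductive sym_rel : sterm -> sterm -> Prop :=
| sym_refl s : sym_rel s s
| sym_sym s t : sym_rel s t -> sym_rel t s
| sym_trans s t u : sym_rel s t -> sym_rel t u -> sym_rel s u
| sym_cat s s' t t' : sym_rel s s' -> sym_rel t t' -> sym_rel (s ++ t) (s' ++ t')
| sym_catC s t : sym_rel (s ++ t) (t ++ s)
| sym_coef0 w : sym_rel [:: (0, w)] [::]
| sym_coefD f g w : sym_rel [:: (f + g, w)] [:: (f, w); (g, w)]
| sym_add f u X Y v :
    sym_rel [:: (f, u ++ (X + Y) :: v)] [:: (f, u ++ X :: v); (f, u ++ Y :: v)]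
| sym_scale f u d g e X v : word_deg d u -> gr A e g ->
    sym_rel [:: (f, u ++ (g *: X) :: v)] [:: (sgn A (d * e) * (f * g), u ++ X :: v)]
| sym_swap f u X d Y e v : vdeg d X -> vdeg e Y ->
    sym_rel [:: (f, u ++ X :: Y :: v)] [:: (sgn A (d * e) * f, u ++ Y :: X :: v)].

Definition sym_relb (s t : sterm) : bool := `[< sym_rel s t >].

Lemma sym_relb_refl : reflexive sym_relb.
Proof. by move=> s; apply/asboolP; apply: sym_refl. Qed.
Lemma sym_relb_sym : symmetric sym_relb.
Proof. by move=> s t; apply/idP/idP => /asboolP h; apply/asboolP; apply: sym_sym. Qed.
Lemma sym_relb_trans : transitive sym_relb.
Proof.
by move=> t s u /asboolP h /asboolP h'; apply/asboolP; apply: sym_trans h h'.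
Qed.

Canonical sym_equiv := EquivRel sym_relb sym_relb_refl sym_relb_sym sym_relb_trans.

Definition sym : Type := {eq_quot sym_equiv}.
HB.instance Definition _ := Choice.on sym.
HB.instance Definition _ := EqQuotient.on sym.

Lemma sym_eqP (s t : sterm) : sym_rel s t <-> \pi_sym s = \pi_sym t.
Proof.
split=> [h|/eqmodP/asboolP//].
by apply/eqmodP/asboolP.
Qed.

Lemma sterm_scale_rel f s t : sym_rel s t -> sym_rel (sterm_scale f s) (sterm_scale f t).
Proof.
elim=> {s t} [s|s t _ h|s t u _ h _ h'|s s' t t' _ h _ h'|s t|w|g h w|g u X Y v
  |g u d h e X v hu hh|g u X d Y e v hX hY]; rewrite /sterm_scale ?map_cat /=.
- exact: sym_refl.
- exact: sym_sym.
- exact: sym_trans h h'.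
- exact: sym_cat.
- exact: sym_catC.
- by rewrite mulr0; apply: sym_coef0.
- by rewrite mulrDr; apply: sym_coefD.
- exact: sym_add.
- by rewrite mulrA sgnC -mulrA [f * (g * h)]mulrA; apply: sym_scale.
- by rewrite mulrA sgnC -mulrA; apply: sym_swap.
Qed.

Definition sym_zero : sym := \pi_sym [::].
Definition sym_plus (x y : sym) : sym := \pi_sym (repr x ++ repr y).
Definition sym_mulf (f : A) (x : sym) : sym := \pi_sym (sterm_scale f (repr x)).
Definition sym_opp (x : sym) : sym := sym_mulf (- 1) x.

Lemma repr_rel s : sym_rel (repr (\pi_sym s)) s.
Proof. by apply/sym_eqP; rewrite reprK. Qed.

Lemma sym_plusE s t : sym_plus (\pi_sym s) (\pi_sym t) = \pi_sym (s ++ t).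
Proof. by apply/sym_eqP; apply: sym_cat; apply: repr_rel. Qed.

Lemma sym_mulfE f s : sym_mulf f (\pi_sym s) = \pi_sym (sterm_scale f s).
Proof. by apply/sym_eqP; apply/sterm_scale_rel/repr_rel. Qed.

Lemma sym_addA : associative sym_plus.
Proof.
move=> x y z; rewrite -[x]reprK -[y]reprK -[z]reprK.
by rewrite (sym_plusE (repr y)) (sym_plusE (repr x) (repr y)) !sym_plusE catA.
Qed.
Lemma sym_addC : commutative sym_plus.
Proof.
move=> x y; rewrite -[x]reprK -[y]reprK !sym_plusE; apply/sym_eqP; exact: sym_catC.
Qed.
Lemma sym_add0 : left_id sym_zero sym_plus.
Proof. by move=> x; rewrite -[x]reprK sym_plusE. Qed.

Lemma sym_mulfA f g x : sym_mulf f (sym_mulf g x) = sym_mulf (f * g) x.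
Proof.
rewrite -[x]reprK; move: (repr x) => s; rewrite (sym_mulfE g) !sym_mulfE /sterm_scale -map_comp.
by congr (\pi_sym _); apply: eq_map => p /=; rewrite mulrA.
Qed.
Lemma sym_mulf1 : left_id 1 sym_mulf.
Proof.
move=> x; rewrite -[x]reprK; move: (repr x) => s; rewrite sym_mulfE /sterm_scale.
by congr (\pi_sym _); rewrite -[RHS]map_id; apply: eq_map => -[f w] /=; rewrite mul1r.
Qed.
Lemma sym_mulfDr : right_distributive sym_mulf sym_plus.
Proof.
move=> f x y; rewrite -[x]reprK -[y]reprK (sym_plusE (repr x)).
rewrite (sym_mulfE _ (repr x)) (sym_mulfE _ (repr y)) sym_mulfE sym_plusE.
by rewrite /sterm_scale map_cat.
Qed.
Lemma sym_mulfDl x : {morph sym_mulf^~ x : f g / f + g >-> sym_plus f g}.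
Proof.
move=> f g; rewrite -[x]reprK; move: (repr x) => s.
rewrite (sym_mulfE f) (sym_mulfE g) sym_mulfE sym_plusE; apply/sym_eqP => {x}.
elim: s => [|[h w] s IH]; first exact: sym_refl.
rewrite /= mulrDl -cat1s -[X in sym_rel _ X]cat1s.
apply: sym_trans (sym_cat (sym_coefD _ _ _) IH) _.
rewrite -[[:: _; _]]cat1s -catA; apply: sym_cat; first exact: sym_refl.
rewrite catA -[X in sym_rel _ (_ ++ X)]cat1s catA.
by apply: sym_cat; [apply: sym_catC | apply: sym_refl].
Qed.
Lemma sym_mulf0 x : sym_mulf 0 x = sym_zero.
Proof.
rewrite -[x]reprK; move: (repr x) => s; rewrite sym_mulfE; apply/sym_eqP => {x}.
elim: s => [|[h w] s IH]; first exact: sym_refl.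
rewrite /= mul0r -cat1s -[X in sym_rel _ X]cat0s.
by apply: sym_cat => //; apply: sym_coef0.
Qed.
Lemma sym_addN : left_inverse sym_zero sym_opp sym_plus.
Proof.
move=> x; rewrite /sym_opp -[X in sym_plus _ X]sym_mulf1 -sym_mulfDl addNr.
exact: sym_mulf0.
Qed.

HB.instance Definition _ := GRing.isZmodule.Build sym sym_addA sym_addC sym_add0 sym_addN.
HB.instance Definition _ :=
  GRing.Zmodule_isLmodule.Build A sym sym_mulfA sym_mulf1 sym_mulfDr sym_mulfDl.

Definition sprod (n : nat) (X : 'I_n -> E) : sym :=
  \pi_sym [:: (1, [seq X i | i <- enum 'I_n])].

Definition sym_fun (f : A) : sym := f *: \pi_sym [:: (1, [::])].

End SymmetricAlgebra.

Section Connections.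
Variables (K : fieldType) (A : galg K).
Let E := vfield A.

(* K-bilinearity of [nabla] : K acts on [E] through [scal] *)
Record connection := Connection {
  nabla :> E -> E -> E;
  nablaDl : forall X Y Z, nabla (X + Y) Z = nabla X Z + nabla Y Z;
  nablaDr : forall X Y Z, nabla X (Y + Z) = nabla X Y + nabla X Z;
  nablaZ : forall c X Y, nabla X (scal A c *: Y) = scal A c *: nabla X Y;
  nabla_deg : forall d e X Y, vdeg d X -> vdeg e Y -> vdeg (d + e) (nabla X Y);
  nabla_fun : forall (f : A) X Y, nabla (f *: X) Y = f *: nabla X Y;
  nabla_Leibniz : forall d e X (f : A) Y, vdeg d X -> gr A e f ->
    nabla X (f *: Y) = (X f : A) *: Y + (sgn A (d * e) * f) *: nabla X Y }.

(* The value at Y_0 ... Y_(n-1) of the extension of nabla_X to the symmetric algebra,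
   for [X] of degree [d] and [Y j] of degree [e j]. *)
Definition nabla_sprod (D : connection) (d : int) (X : E) (n : nat) (e : 'I_n -> int)
    (Y : 'I_n -> E) : sym A :=
  \sum_(k < n) sgn A (d * \sum_(j < n | (j < k)%N) e j) *:
     sprod (fun j => if j == k then D X (Y k) else Y j).

End Connections.

Inductive ground := RealGround | ComplexGround.

Section Smooth.
Variables (R : realType).

Definition ground_field (k : ground) : fieldType :=
  match k with RealGround => R : fieldType | ComplexGround => R[i] : fieldType end.

Definition re_part (k : ground) : ground_field k -> R :=
  match k with RealGround => fun x => x | ComplexGround => fun z => complex.Re z end.
Definition im_part (k : ground) : ground_field k -> R :=
  match k with RealGround => fun=> 0 | ComplexGround => fun z => complex.Im z end.

(* [f] is of class C^r on the open set [U] *)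
Fixpoint Cr (n r : nat) (U : set 'rV[R]_n) (f : 'rV[R]_n -> R) : Prop :=
  (forall x, U x -> {for x, continuous f}) /\
  (if r is r'.+1 then forall i : 'I_n,
     (forall x, U x -> derivable f x (delta_mx 0 i)) /\
     Cr r' U (fun x => 'D_(delta_mx 0 i) f x)
   else True).

Definition smooth (n : nat) (U : set 'rV[R]_n) (f : 'rV[R]_n -> R) : Prop :=
  forall r, Cr r U f.

Record chart (M : topologicalType) (n : nat) := Chart {
  cdom : set M;
  cimg : set 'rV[R]_n;
  cfun :> M -> 'rV[R]_n;
  cinv : 'rV[R]_n -> M;
  cdom_open : open cdom;
  cimg_open : open cimg;
  cfun_img : forall x, cdom x -> cimg (cfun x);
  cinv_dom : forall y, cimg y -> cdom (cinv y);
  cfunK : forall x, cdom x -> cinv (cfun x) = x;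
  cinvK : forall y, cimg y -> cfun (cinv y) = y;
  cfun_continuous : forall x, cdom x -> {for x, continuous cfun};
  cinv_continuous : forall y, cimg y -> {for y, continuous cinv} }.

Record smooth_manifold (n : nat) := SmoothManifold {
  mspace :> topologicalType;
  mspace_hausdorff : hausdorff_space mspace;
  mspace_second_countable : @second_countable mspace;
  atlas : set (chart mspace n);
  atlas_cover : forall x : mspace, exists2 c, atlas c & cdom c x;
  atlas_smooth : forall c c', atlas c -> atlas c' -> forall j : 'I_n,
    smooth (cimg c `&` cinv c @^-1` cdom c') (fun y => c' (cinv c y) ord0 j) }.

(* k-valued smooth functions on the open set [W], extended by 0 outside [W] *)
Definition smooth_fun (k : ground) (n : nat) (M : smooth_manifold n) (W : set M)
    (f : M -> ground_field k) : Prop :=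
  (forall x, ~ W x -> f x = 0) /\
  forall c, atlas c ->
    smooth (cimg c `&` cinv c @^-1` W) (fun y => re_part (f (cinv c y))) /\
    smooth (cimg c `&` cinv c @^-1` W) (fun y => im_part (f (cinv c y))).

End Smooth.

Record open_set (M : topologicalType) := OpenSet { oset :> set M; osetP : open oset }.

Lemma openTs (M : topologicalType) : open [set: M]. Proof. exact: openT. Qed.
Definition whole (M : topologicalType) : open_set M := OpenSet (openTs M).

(* A sheaf of Z-graded algebras: limits of Z-graded algebras are computed degree
   by degree, hence the gluing condition bears on homogeneous sections. *)
Record gsheaf (K : fieldType) (M : topologicalType) := GSheaf {
  sections :> open_set M -> galg K;
  res : forall U V : open_set M, V `<=` U -> {rmorphism sections U -> sections V};
  res_scal : forall (U V : open_set M) (h : V `<=` U) c,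
    res h (scal (sections U) c) = scal (sections V) c;
  res_gr : forall (U V : open_set M) (h : V `<=` U) d s,
    gr (sections U) d s -> gr (sections V) d (res h s);
  res_id : forall (U : open_set M) (h : U `<=` U) s, res h s = s;
  res_comp : forall (U V W : open_set M) (h : V `<=` U) (h' : W `<=` V) (h'' : W `<=` U) s,
    res h' (res h s) = res h'' s;
  sheaf_glue : forall (d : int) (I : Type) (U : open_set M) (V : I -> open_set M)
      (hV : forall i, V i `<=` U),
    (U : set M) `<=` \bigcup_i V i ->
    forall s : forall i, sections (V i),
    (forall i, gr (sections (V i)) d (s i)) ->
    (forall i j (W : open_set M) (hi : W `<=` V i) (hj : W `<=` V j),
       res hi (s i) = res hj (s j)) ->
    exists! t, gr (sections U) d t /\ forall i, res (hV i) t = s i }.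

(* The local model C^oo(W) tensor S(V dual), completed: formal power series, with
   coefficients in C^oo(W), in the coordinates xi_j dual to a homogeneous basis (e_j) of V;
   [v j] is the degree of e_j, so xi_j has degree - v j. A monomial is a tuple of exponents,
   and stands for the product of the xi_j ^ a_j in increasing order of j. *)
Section LocalModel.
Variables (R : realType) (k : ground) (n : nat) (M : smooth_manifold R n).
Variables (m : nat) (v : 'I_m -> int).
Local Notation K := (ground_field R k).

Definition monomial := {ffun 'I_m -> nat}.

(* odd coordinates square to zero *)
Definition mon_ok (a : monomial) : bool := [forall j, odd `|v j| ==> (a j <= 1)%N].

Definition mon_deg (a : monomial) : int := \sum_j (a j)%:Z * - v j.

(* xi^a xi^b = mon_sgn a b xi^(a+b) when [mon_ok (a + b)] *)
Definition mon_sgn (a b : monomial) : K :=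
  (-1) ^+ (\sum_(i < m) \sum_(j < m | (j < i)%N) (a i * b j * (`|v i| * `|v j|)))%N.

Definition pseries := monomial -> M -> K.

Definition pseries_one (W : set M) : pseries :=
  fun a x => ((a == [ffun=> 0%N]) && (x \in W))%:R.

(* the sum ranges over the divisors a of the monomial c *)
Definition pseries_mul (f g : pseries) : pseries := fun c x =>
  if mon_ok c then
    \sum_(a : {ffun 'I_m -> 'I_(\sum_j c j).+1} | [forall j, (a j <= c j)%N])
       let a' := [ffun j => val (a j)] in let b := [ffun j => c j - a j]%N in
       mon_sgn a' b * f a' x * g b x
  else 0.

Definition pseries_homog (W : set M) (d : int) : set pseries :=
  [set f | forall a, smooth_fun W (f a) /\
     (~~ (mon_ok a && (mon_deg a == d)) -> forall x, f a x = 0)].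

(* an isomorphism of sheaves of graded algebras, over the open set [U], from [O] to
   the local model (only the [phi W] with W included in U matter) *)
Record local_iso (O : gsheaf K M) (U : open_set M)
    (phi : forall W : open_set M, O W -> pseries) : Prop := {
  liso_add : forall (W : open_set M), W `<=` U -> forall s t a x,
    phi W (s + t) a x = phi W s a x + phi W t a x;
  liso_scal : forall (W : open_set M), W `<=` U -> forall c s a x,
    phi W (scal (O W) c * s) a x = c * phi W s a x;
  liso_one : forall (W : open_set M), W `<=` U -> phi W 1 = pseries_one W;
  liso_mul : forall (W : open_set M), W `<=` U -> forall s t,
    phi W (s * t) = pseries_mul (phi W s) (phi W t);
  liso_bij : forall (W : open_set M), W `<=` U -> forall d,
    set_bij (gr (O W) d) (pseries_homog W d) (phi W);
  liso_res : forall (W W' : open_set M) (h : W' `<=` W), W `<=` U -> forall s a x,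
    phi W' (res O h s) a x = if x \in (W' : set M) then phi W s a x else 0 }.

End LocalModel.

(* finite-dimensional: both the support and V are *)
Record graded_manifold (R : realType) (k : ground) := GradedManifold {
  gm_dim : nat;
  gm_supp : smooth_manifold R gm_dim;
  gm_rank : nat;
  gm_deg : 'I_gm_rank -> int;
  gm_sheaf : gsheaf (ground_field R k) gm_supp;
  gm_local : forall x : gm_supp, exists2 U : open_set gm_supp, oset U x &
    exists phi, @local_iso R k gm_dim gm_supp gm_rank gm_deg gm_sheaf U phi }.

Definition Cinfty (R : realType) (k : ground) (M : graded_manifold R k) :
    galg (ground_field R k) := gm_sheaf M (whole (gm_supp M)).

(* Main.v *)
Require Import Defs.
From HB Require Import structures.
From mathcomp Require Import all_boot all_order all_algebra zify generic_quotient.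
From mathcomp Require Import all_classical all_reals all_analysis.
Import GRing.Theory.
Local Open Scope ring_scope.
Local Open Scope quotient_scope.
Set Implicit Arguments.
Unset Strict Implicit.
Unset Printing Implicit Defensive.

(** Uniqueness: products of homogeneous vector fields generate the symmetric algebra as a
   module over the functions ([sym_ind]), and the recursive formula reduces the value at a
   product of n+1 of them to values at products of n of them.

   Existence: the formula is taken as the definition of functions [pbw_word n] on words of
   n vector fields, and induction on n shows that these are additive in each letter, graded
   symmetric, and linear over the functions ([pbw_word_multilinear]), which is what is
   needed to descend to the symmetric algebra. Additivity and symmetry hold because the
   formula is a sum over all the letters, each brought to the front with its sign, and
   because the extension of nabla to words is a derivation. By symmetry, linearity has to
   be checked only for the first letter. When a letter f X is picked, the factor f comes out
   because both X . P and nabla_X are linear over the functions in X. When another letter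
   Z is picked and f stays in the remaining word, both Z . (f P) and nabla_Z (f X) follow
   the Leibniz rule: the two terms that contain Z(f) have opposite signs and cancel, and f
   comes out of the rest ([pbw_pick_head]).

   The argument is algebraic, and is carried out over an arbitrary graded commutative
   algebra of functions ([formal_exponential_exists_unique]).

   The letters of a word need not be homogeneous, but the signs depend on parities only. An
   object of parity p that moves past a letter applies to it the p-th power [tw] of the
   parity automorphism. With this convention the recursive formula makes sense for
   arbitrary letters, of which only the one that moves is split into its even and odd
   parts, and it is additive in all of them. *)

(** * Signs and parities *)

(** The sign (-1)^b as an operation on abelian groups, so that one notion of sign applies
   to functions, vector fields and operators alike. *)
Definition osgn (V : zmodType) (b : bool) (x : V) : V := if b then - x else x.

Lemma osgn0 (V : zmodType) b : osgn b (0 : V) = 0.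
Proof. by case: b; rewrite /= ?oppr0. Qed.

Lemma osgnD (V : zmodType) b (x y : V) : osgn b (x + y) = osgn b x + osgn b y.
Proof. by case: b; rewrite //= opprD. Qed.

Lemma osgn_addb (V : zmodType) b c (x : V) : osgn b (osgn c x) = osgn (b (+) c) x.
Proof. by case: b c => [] [] /=; rewrite ?opprK. Qed.

Lemma osgnZ (R : pzRingType) (V : lmodType R) b (f : R) (x : V) :
  f *: osgn b x = osgn b (f *: x).
Proof. by case: b; rewrite //= scalerN. Qed.

Definition parity (d : int) : bool := odd `|d|%N.

Lemma parityD d e : parity (d + e) = parity d (+) parity e.
Proof. by case: d e => [m|m] [n|n]; rewrite /parity; lia. Qed.

Lemma parityM d e : parity (d * e) = parity d && parity e.
Proof. by rewrite /parity abszM oddM. Qed.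

Lemma sgnZE (K : fieldType) (A : galg K) (V : lmodType A) d (x : V) :
  sgn A d *: x = osgn (parity d) x.
Proof.
by rewrite /sgn -signr_odd /parity; case: odd; rewrite ?scaleN1r ?scale1r.
Qed.

Section ParityParts.
Variables (V : zmodType) (G : grading V).

Let homogs (l : seq (int * V)) : Prop := {in l, forall i, G i.1 i.2}.

Lemma homogs_exists x : exists l, homogs l /\ \sum_(i <- l) i.2 = x.
Proof.
elim: (homog_span G x) => [|d y z hy _ [l [hl <-]]].
  by exists [::]; split=> //; rewrite big_nil.
exists ((d, y) :: l); split; last by rewrite big_cons.
by move=> i; rewrite inE => /predU1P[->|/hl].
Qed.

(** The sum is regrouped by degree, and each group vanishes by independence. *)
Lemma homogs_part0 (P : pred int) l :
  homogs l -> \sum_(i <- l) i.2 = 0 -> \sum_(i <- l | P i.1) i.2 = 0.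
Proof.
move=> hl; pose s := undup (map fst l); pose c d := \sum_(i <- l | i.1 == d) i.2.
have E (Q : pred int) : \sum_(i <- l | Q i.1) i.2 = \sum_(d <- s | Q d) c d.
  rewrite (exchange_big_dep (fun i => Q i.1)) /=; last by move=> d i Qd /eqP->.
  rewrite big_seq_cond [RHS]big_seq_cond; apply: eq_bigr => i /andP[il Qi].
  rewrite big_mkcond (bigD1_seq i.1) ?undup_uniq ?mem_undup ?map_f//= Qi eqxx /=.
  by rewrite big1 ?addr0// => d; rewrite eq_sym => /negPf->; rewrite andbF.
have hc d : G d (c d).
  rewrite /c big_seq_cond; elim/big_ind: _ => [|x y hx hy|i /andP[il /eqP<-]].
  - exact: homog0.
  - rewrite -[y]opprK; apply: homogB => //.
    by rewrite -sub0r; apply: homogB => //; apply: homog0.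
  - exact: hl.
rewrite (E predT) (E P) => /(homog_indep (undup_uniq _) hc) c0.
by rewrite big_seq_cond big1 // => d /andP[/c0].
Qed.

(** The signs of the graded calculus depend on degrees through their parities, so it is
   enough to group the homogeneous components of x by parity. By [partE] the choice of a
   decomposition of x does not matter. *)
Definition part (p : bool) (x : V) : V :=
  \sum_(i <- projT1 (cid (homogs_exists x)) | parity i.1 == p) i.2.

Lemma partE p l : homogs l ->
  part p (\sum_(i <- l) i.2) = \sum_(i <- l | parity i.1 == p) i.2.
Proof.
move=> hl; rewrite /part; case: cid => l' /= [hl' E].
pose m := l' ++ [seq (i.1, - i.2) | i <- l].
have hm : homogs m.
  move=> i; rewrite mem_cat => /orP[/hl'//|/mapP[j jl ->]] /=.
  by rewrite -sub0r; apply: homogB; [apply: homog0 | apply: hl].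
have := @homogs_part0 (fun d => parity d == p) m hm.
rewrite !big_cat !big_map /= E !sumrN subrr => /(_ erefl)/eqP.
by rewrite subr_eq0 => /eqP.
Qed.

Lemma partD p : {morph part p : x y / x + y}.
Proof.
move=> x y; have [l [hl <-]] := homogs_exists x; have [m [hm <-]] := homogs_exists y.
rewrite !partE// -!big_cat partE// => i; rewrite mem_cat => /orP[/hl|/hm] //.
Qed.

Lemma part0 p : part p 0 = 0.
Proof. by apply: (addrI (part p 0)); rewrite -partD !addr0. Qed.

Lemma part_homog p d x : G d x -> part p x = if parity d == p then x else 0.
Proof.
move=> hx; have := @partE p [:: (d, x)]; rewrite big_seq1 => ->.
  by rewrite big_mkcond big_seq1.
by move=> i; rewrite inE => /eqP->.
Qed.

Lemma part_sum x : part false x + part true x = x.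
Proof.
elim: (homog_span G x) => [|d y z hy _ IH]; first by rewrite !part0 addr0.
rewrite !partD addrACA IH !(part_homog _ hy).
by case: parity; rewrite ?add0r ?addr0.
Qed.

Lemma partN p : {morph part p : x / - x}.
Proof. by move=> x; apply: (addrI (part p x)); rewrite -partD !subrr part0. Qed.

(** As an equation, being of parity p makes sense for sums of homogeneous elements of
   several degrees; zero has both parities. *)
Definition par (p : bool) (x : V) : Prop := part p x = x.

Lemma par0 p : par p 0. Proof. exact: part0. Qed.
Lemma parD p x y : par p x -> par p y -> par p (x + y).
Proof. by rewrite /par partD => -> ->. Qed.
Lemma parN p x : par p x -> par p (- x).
Proof. by rewrite /par partN => ->. Qed.
Lemma par_osgn p b x : par p x -> par p (osgn b x).
Proof. by case: b => //; apply: parN. Qed.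

Lemma par_homog d x : G d x -> par (parity d) x.
Proof. by move=> hx; rewrite /par (part_homog _ hx) eqxx. Qed.

Lemma part_par p x : par p (part p x).
Proof.
elim: (homog_span G x) => [|d y z hy _ IH]; rewrite ?part0 ?partD; first exact: par0.
apply: parD => //; rewrite (part_homog _ hy); case: eqP => [<-|_]; last exact: par0.
exact: par_homog.
Qed.

Lemma part_same p x : par p x -> part p x = x. Proof. by []. Qed.

Lemma part_other p x : par p x -> part (~~ p) x = 0.
Proof.
move=> hx; have := part_sum x; case: p hx => /= hx; rewrite (part_same hx).
  by move/eqP; rewrite -subr_eq0 addrK => /eqP.
by move/eqP; rewrite eq_sym -subr_eq0 opprD addNKr oppr_eq0 => /eqP.
Qed.

Lemma homog_ind (P : V -> Prop) : P 0 -> (forall x y, P x -> P y -> P (x + y)) ->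
  (forall d x, G d x -> P x) -> forall x, P x.
Proof. by move=> P0 PD PG x; elim: (homog_span G x) => // d y z /PG; auto. Qed.

(** An element of parity p is its own part of parity p, hence a sum of homogeneous
   elements of degrees of parity p. *)
Lemma par_ind p (P : V -> Prop) : P 0 -> (forall x y, P x -> P y -> P (x + y)) ->
  (forall d x, parity d = p -> G d x -> P x) -> forall x, par p x -> P x.
Proof.
move=> P0 PD PG x <-; elim/homog_ind: x => [|x y|d x hx]; rewrite ?part0 ?partD; auto.
by rewrite (part_homog _ hx); case: eqP => // pd; apply: PG hx.
Qed.

Lemma part_ind (P : V -> Prop) : (forall x y, P x -> P y -> P (x + y)) ->
  (forall p x, par p x -> P x) -> forall x, P x.
Proof. by move=> PD Pp x; rewrite -(part_sum x); apply: PD; apply: Pp (part_par _ _). Qed.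

End ParityParts.

(** The p-th power of the parity automorphism, which is (-1)^q on elements of parity q: it
   is the sign that appears when an object of parity p moves past x. The definition is
   locked to keep rewriting with addition lemmas from unfolding it. *)
HB.lock Definition tw (V : zmodType) (G : grading V) (p : bool) (x : V) : V :=
  part G false x + osgn p (part G true x).

Section ParityTwists.
Variables (V : zmodType) (G : grading V).
Local Notation par := (par G).
Local Notation tw := (tw G).

Lemma twD p : {morph tw p : x y / x + y}.
Proof. by move=> x y; rewrite unlock !partD osgnD addrACA. Qed.

Lemma tw0 p : tw p 0 = 0. Proof. by rewrite unlock !part0 osgn0 addr0. Qed.

Lemma tw_par p q x : par q x -> tw p x = osgn (p && q) x.
Proof.
rewrite unlock => hx; case: q hx => hx; rewrite (part_same hx) (part_other hx).
  by rewrite add0r andbT.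
by rewrite osgn0 addr0 andbF.
Qed.

Lemma par_tw p q x : par q x -> par q (tw p x).
Proof. by move=> hx; rewrite (tw_par _ hx); apply: par_osgn. Qed.

Lemma tw_addb p q x : tw p (tw q x) = tw (p (+) q) x.
Proof.
elim/(@part_ind _ G): x => [x y|r x hx]; first by rewrite !twD => -> ->.
by rewrite (tw_par p (par_tw q hx)) !(tw_par _ hx) osgn_addb -andb_addl.
Qed.

Lemma tw_false x : tw false x = x. Proof. by rewrite unlock; exact: part_sum. Qed.

Lemma twK p : involutive (tw p).
Proof. by move=> x; rewrite tw_addb addbb tw_false. Qed.

End ParityTwists.

(** * Parity of functions and of vector fields *)

Section GradedVectorFields.
Variables (K : fieldType) (A : galg K).
Local Notation E := (vfield A).

Lemma vfield_eq (X Y : E) : (forall f, (X f : A) = Y f) -> X = Y.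
Proof. by move=> XY; apply: val_inj; apply: (@funext A A). Qed.

Lemma vfun0 f : ((0 : E) f : A) = 0. Proof. by []. Qed.
Lemma vfunD (X Y : E) f : ((X + Y) f : A) = X f + Y f. Proof. by []. Qed.
Lemma vfunB (X Y : E) f : ((X - Y) f : A) = X f - Y f. Proof. by []. Qed.

Lemma vdeg0 d : vdeg d (0 : E).
Proof.
split; first by split=> *; rewrite vfun0 ?addr0 ?mulr0.
  by move=> e a _; apply: gr0.
by move=> e f g _; rewrite !vfun0 mul0r !mulr0 addr0.
Qed.

Lemma vdegB d (X Y : E) : vdeg d X -> vdeg d Y -> vdeg d (X - Y).
Proof.
move=> [[XD XZ] Xd XL] [[YD YZ] Yd YL]; split.
- split=> [a b|c a]; rewrite !vfunB; last by rewrite XZ YZ mulrBr.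
  by rewrite XD YD opprD addrACA.
- by move=> e a ha; apply: homogB; [apply: Xd | apply: Yd].
move=> e f g hf; rewrite !vfunB (XL _ _ _ hf) (YL _ _ _ hf) mulrBl !mulrBr.
by rewrite opprD addrACA.
Qed.

Lemma vdegZ d e f (X : E) : gr A e f -> vdeg d X -> vdeg (e + d) (f *: X).
Proof. exact: derivationZ. Qed.

Lemma vdeg_span (X : E) : graded_span (@vdeg K A) X.
Proof.
case: X => X hX; move/asboolP: (hX) => sX.
elim: sX hX => [|d Y Z hY sZ IH] hX.
  suff -> : VField hX = 0 by apply: Defs.span_nil.
  exact: vfield_eq.
have hZ : Z \in @vfield_pred K A by apply/asboolP.
have hY' : Y \in @vfield_pred K A by apply/asboolP/span1/hY.
suff -> : VField hX = VField hY' + VField hZ.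
  exact: Defs.span_cons (hY : vdeg d (VField hY')) (IH hZ).
exact: vfield_eq.
Qed.

(** On a function of degree e, vector fields of distinct degrees take values in distinct
   degrees, and a derivation is determined by its values on homogeneous functions. *)
Lemma vdeg_indep (s : seq int) (c : int -> E) :
  uniq s -> (forall d, vdeg d (c d)) -> \sum_(d <- s) c d = 0 ->
  forall d, d \in s -> c d = 0.
Proof.
move=> us hc c0 d ds; apply: vfield_eq.
have [[cD _] _ _] := hc d; elim/gr_spanP => [|e a b ha IH].
  by rewrite vfun0; apply: klinear0 cD.
rewrite cD IH vfun0 addr0.
pose c' i : A := c (i - e) a.
have vsum (r : seq int) : ((\sum_(i <- r) c i) a : A) = \sum_(i <- r) (c i a : A).
  by elim: r => [|i r IHr]; rewrite ?big_nil ?big_cons // vfunD IHr.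
have := @homog_indep _ (gr A) [seq i + e | i <- s] c' _ _ _ (d + e).
rewrite /c' addrK; apply.
- by rewrite map_inj_uniq //; apply: addIr.
- by move=> i; rewrite -{1}[i](subrK e); case: (hc (i - e)) => _ + _; apply.
- by rewrite big_map -[RHS](vfun0 a) -c0 vsum; apply: eq_bigr => i _; rewrite addrK.
- exact: map_f.
Qed.

Definition vgrading : grading E :=
  @Grading E (@vdeg K A) vdeg0 vdegB vdeg_span vdeg_indep.

Local Notation apar := (par (gr A)).
Local Notation atw := (tw (gr A)).
Local Notation vpar := (par vgrading).
Local Notation vtw := (tw vgrading).

Lemma par_scale p q (f : A) (X : E) : apar p f -> vpar q X -> vpar (p (+) q) (f *: X).
Proof.
move=> hf; elim/par_ind => [|Y Z|d Y <- hY]; first by rewrite scaler0; apply: par0.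
  by rewrite scalerDr; apply: parD.
move: f hf; apply: par_ind => [|f g|e f <- hf]; first by rewrite scale0r; apply: par0.
  by rewrite scalerDl; apply: parD.
by rewrite -parityD; apply: (@par_homog _ vgrading); apply: vdegZ.
Qed.

Lemma tw_scale p (f : A) (X : E) : vtw p (f *: X) = atw p f *: vtw p X.
Proof.
elim/(@part_ind _ (gr A)): f => [f g Ef Eg|q f hf].
  by rewrite scalerDl !twD Ef Eg -scalerDl.
elim/(@part_ind _ vgrading): X => [Y Z EY EZ|r X hX].
  by rewrite scalerDr !twD EY EZ -scalerDr.
rewrite (tw_par _ (par_scale hf hX)) (tw_par _ hf) (tw_par _ hX) osgnZ andb_addr.
rewrite addbC -osgn_addb; congr osgn.
by case: (p && q); rewrite //= scaleNr.
Qed.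

Lemma vfun_add (X : E) f g : (X (f + g) : A) = X f + X g.
Proof.
elim/(@homog_ind _ vgrading): X => [|Y Z EY EZ|d Y [[YD _] _ _]]; rewrite ?vfun0 ?addr0//.
by rewrite !vfunD EY EZ addrACA.
Qed.

Lemma vfun_Leibniz p (X : E) (f g : A) : vpar p X ->
  (X (f * g) : A) = (X f : A) * g + atw p f * X g.
Proof.
elim/par_ind => [|Y Z EY EZ|d Y <- hY]; first by rewrite !vfun0 mul0r mulr0 addr0.
  by rewrite !vfunD EY EZ mulrDl mulrDr addrACA.
elim/(@homog_ind _ (gr A)): f => [|f h Ef Eh|e f hf].
- by rewrite tw0 !mul0r klinear0 ?mul0r ?addr0//; case: hY => -[].
- by rewrite mulrDl !vfun_add twD Ef Eh !mulrDl addrACA.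
case: hY => _ _ /(_ _ _ _ hf) ->; congr (_ + _).
rewrite (tw_par _ (par_homog hf)) -parityM -[osgn _ f](@sgnZE K A A^o).
by rewrite -mulrA.
Qed.

Section Nabla.
Variable D : connection A.

Lemma nabla0l X : D 0 X = 0.
Proof. by apply: (addrI (D 0 X)); rewrite -nablaDl !addr0. Qed.
Lemma nabla0r X : D X 0 = 0.
Proof. by apply: (addrI (D X 0)); rewrite -nablaDr !addr0. Qed.

Lemma nabla_par p q X Y : vpar p X -> vpar q Y -> vpar (p (+) q) (D X Y).
Proof.
move=> hX; elim/par_ind => [|Y' Z|e Y' <- hY].
- by rewrite nabla0r; apply: par0.
- by rewrite nablaDr; apply: parD.
move: X hX; apply: par_ind => [|X' Z|d X <- hX].
- by rewrite nabla0l; apply: par0.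
- by rewrite nablaDl; apply: parD.
by rewrite -parityD; apply: (@par_homog _ vgrading); apply: nabla_deg.
Qed.

Lemma nabla_scale p X (f : A) Y : vpar p X ->
  D X (f *: Y) = (X f : A) *: Y + atw p f *: D X Y.
Proof.
elim/par_ind => [|X' Z EX EZ|d X' <- hX].
- by rewrite !nabla0l vfun0 scale0r scaler0 addr0.
- by rewrite !nablaDl vfunD EX EZ scalerDl scalerDr addrACA.
elim/(@homog_ind _ (gr A)): f => [|f h Ef Eh|e f hf].
- by rewrite tw0 !scale0r nabla0r klinear0 ?scale0r ?addr0//; case: hX => -[].
- by rewrite scalerDl nablaDr vfun_add twD Ef Eh !scalerDl addrACA.
rewrite (nabla_Leibniz D _ hX hf); congr (_ + _ *: _).
by rewrite (tw_par _ (par_homog hf)) -parityM -[osgn _ f](@sgnZE K A A^o).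
Qed.
End Nabla.

End GradedVectorFields.

(** * Functions of words of vector fields *)

Section WordFunctions.
Variables (K : fieldType) (A : galg K) (V : lmodType A).
Local Notation E := (vfield A).
Local Notation apar := (par (gr A)).
Local Notation atw := (tw (gr A)).
Local Notation vpar := (par (vgrading A)).
Local Notation vtw := (tw (vgrading A)).
Implicit Types (F : seq E -> V) (u v w : seq E) (X Y Z : E) (p q : bool).

Definition word_additive F := forall u X Y v,
  F (u ++ (X + Y) :: v) = F (u ++ X :: v) + F (u ++ Y :: v).

Definition word_symmetric F := forall u p q X Y v, vpar p X -> vpar q Y ->
  F (u ++ X :: Y :: v) = osgn (p && q) (F (u ++ Y :: X :: v)).

(** A factor of parity p comes out of the word through the letters on its left. *)
Definition word_linear F := forall u p f X v, apar p f ->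
  F (u ++ f *: X :: v) = f *: F (map (vtw p) u ++ X :: v).

Lemma word_additive_cons X F : word_additive F -> word_additive (fun v => F (X :: v)).
Proof. by move=> FD u; apply: (FD (X :: u)). Qed.

Lemma word_symmetric_cons X F :
  word_symmetric F -> word_symmetric (fun v => F (X :: v)).
Proof. by move=> FS u; apply: (FS (X :: u)). Qed.

Lemma word_additive0 F u v : word_additive F -> F (u ++ 0 :: v) = 0.
Proof. by move=> FD; apply: (addrI (F (u ++ 0 :: v))); rewrite -FD !addr0. Qed.

Lemma word_additive_osgn F b u X v : word_additive F ->
  F (u ++ osgn b X :: v) = osgn b (F (u ++ X :: v)).
Proof.
move=> FD; case: b => //=; apply: (addrI (F (u ++ X :: v))).
by rewrite -FD !subrr word_additive0.
Qed.

(** Symmetry without a parity for Y: the two parities of Y get their own signs, which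
   amounts to twisting Y. *)
Lemma word_symmetric_tw F u p X Y v : word_additive F -> word_symmetric F ->
  vpar p X -> F (u ++ Y :: X :: v) = F (u ++ X :: vtw p Y :: v).
Proof.
move=> FD FS hX; elim/(@part_ind _ (vgrading A)): Y => [Y Z EY EZ|q Y hY].
  rewrite FD EY EZ twD.
  by have /= := FD (rcons u X) (vtw p Y) (vtw p Z) v; rewrite !cat_rcons => ->.
rewrite (tw_par _ hY) (FS _ _ _ _ _ _ hY hX) andbC.
by have := word_additive_osgn (p && q) (rcons u X) Y v FD; rewrite !cat_rcons => ->.
Qed.

Lemma word_symmetric_head F p u X v : word_additive F -> word_symmetric F ->
  vpar p X -> F (u ++ X :: v) = F (X :: map (vtw p) u ++ v).
Proof.
move=> FD FS hX; elim: u F FD FS => //= Y u IH F FD FS.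
rewrite (IH (fun v => F (Y :: v))); last exact: word_symmetric_cons.
  exact: (word_symmetric_tw [::]).
exact: word_additive_cons.
Qed.

(** By symmetry the factor can be brought to the front together with its vector field,
   extracted there, and the vector field brought back. *)
Lemma word_linear_head F : word_additive F -> word_symmetric F ->
  (forall f X v, F (f *: X :: v) = f *: F (X :: v)) -> word_linear F.
Proof.
move=> FD FS FZ u p f X v hf.
elim/(@part_ind _ (vgrading A)): X => [X Y EX EY|q X hX].
  by rewrite scalerDr !FD EX EY scalerDr.
rewrite (word_symmetric_head _ _ FD FS (par_scale hf hX)) FZ.
rewrite (word_symmetric_head _ _ FD FS hX) -map_comp; congr (_ *: F (_ :: _ ++ _)).
by apply: eq_map => Y /=; rewrite tw_addb addbC.
Qed.

Section Derivative.
Variables (D : connection A) (p : bool) (Z : E).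

(** The value at w of F composed with nabla_Z, for Z of parity p; a letter that is passed
   by Z is twisted. *)
Fixpoint deriv_word F w : V :=
  if w is X :: v then F (D Z X :: v) + deriv_word (fun v => F (vtw p X :: v)) v else 0.

Lemma deriv_word_eq F F' w : F =1 F' -> deriv_word F w = deriv_word F' w.
Proof.
by elim: w F F' => //= X w IH F F' FF'; rewrite FF'; congr (_ + _); apply: IH => v.
Qed.

Lemma deriv_wordD F F' w :
  deriv_word (fun v => F v + F' v) w = deriv_word F w + deriv_word F' w.
Proof.
by elim: w F F' => [|X w IH] F F' /=; rewrite ?addr0// (IH (fun v => F (_ :: v))) addrACA.
Qed.

Lemma deriv_word_morph (phi : V -> V) F w : phi 0 = 0 -> {morph phi : x y / x + y} ->
  deriv_word (fun v => phi (F v)) w = phi (deriv_word F w).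
Proof.
move=> phi0 phiD; elim: w F => [|X w IH] F //=.
by rewrite phiD (IH (fun v => F (_ :: v))).
Qed.

Lemma deriv_word_additive F : word_additive F -> word_additive (deriv_word F).
Proof.
move=> FD u X Y v; elim: u F FD => [|W u IH] F FD /=.
  rewrite nablaDr (FD [::]) addrACA -deriv_wordD; congr (_ + _ + _).
  by apply: deriv_word_eq => w; rewrite twD (FD [::]).
have /= -> := FD (D Z W :: u) X Y v.
by rewrite (IH _ (word_additive_cons _ FD)) addrACA.
Qed.

(** Besides the terms where the derivation acts elsewhere, it acts on X or on Y; each of
   these two terms is matched with the one where it acts on the same letter after the
   exchange. *)
Lemma deriv_word_symmetric F : vpar p Z -> word_additive F -> word_symmetric F ->
  word_symmetric (deriv_word F).
Proof.
move=> hZ FD FS u q r X Y v hX hY; elim: u F FD FS => [|W u IH] F FD FS /=.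
  rewrite (FS [::] _ _ _ _ _ (nabla_par D hZ hX) hY).
  rewrite (FS [::] _ _ _ _ _ (par_tw p hX) (nabla_par D hZ hY)) /=.
  rewrite (tw_par p hX) (tw_par p hY) !(word_additive_osgn _ [::])//.
  rewrite (word_additive_osgn _ [:: _])// !osgnD !osgn_addb !addrA.
  rewrite [osgn _ (F (Y :: _)) + _]addrC; congr (_ + _ + _).
  - by congr osgn; case: (p) q r {hX hY hZ} => [] [] [].
  - by congr osgn; case: (p) q r {hX hY hZ} => [] [] [].
  rewrite -(deriv_word_morph _ _ (osgn0 V _) (@osgnD V _)); apply: deriv_word_eq => w.
  exact: (FS [::]) (par_osgn _ hX) (par_osgn _ hY).
have /= -> := FS (D Z W :: u) _ _ _ _ v hX hY.
by rewrite (IH _ (word_additive_cons _ FD) (word_symmetric_cons _ FS)) -osgnD.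
Qed.

End Derivative.

Lemma deriv_word_addZ D p F Z Z' w : word_additive F ->
  deriv_word D p (Z + Z') F w = deriv_word D p Z F w + deriv_word D p Z' F w.
Proof.
move=> FD; elim: w F FD => [|X w IH] F FD /=; first by rewrite addr0.
have /= FD' := FD [::].
by rewrite nablaDl FD' (IH _ (word_additive_cons _ FD)) addrACA.
Qed.

(** After the derivation has passed the letters t, F stands for the value of the initial
   function at words that begin with t twisted by q, and F' for the value at words that
   begin with t twisted by p + q. The factor f, of parity p, comes out of nabla in the
   latter through t, and so replaces the second twist by the first. *)
Lemma deriv_word_scaleZ_gen D p q f Z F F' w :
  (forall u X v, F' (u ++ f *: X :: v) = f *: F (map (vtw p) u ++ X :: v)) ->
  deriv_word D (p (+) q) (f *: Z) F' w = f *: deriv_word D q Z F w.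
Proof.
elim: w F F' => [|X w IH] F F' FF' /=; first by rewrite scaler0.
rewrite nabla_fun (FF' [::]) scalerDr; congr (_ + _); apply: IH => u Y v.
have /= -> := FF' (vtw (p (+) q) X :: u) Y v.
by rewrite tw_addb addKb.
Qed.

Lemma deriv_word_scaleZ D p q f Z F w : word_linear F -> apar p f ->
  deriv_word D (p (+) q) (f *: Z) F w = f *: deriv_word D q Z F w.
Proof. by move=> FL hf; apply: deriv_word_scaleZ_gen => u X v; apply: FL. Qed.

Section PickSum.
Implicit Types G : bool -> E -> seq E -> V.

(** Each letter in turn is brought to the front of the word and handed over to G, cut in its
   two parities because the sign of the move depends on them. *)
Fixpoint pick_sum G w : V :=
  if w is X :: v then
    G false (part (vgrading A) false X) v + G true (part (vgrading A) true X) v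
    + pick_sum (fun p Z v => G p Z (vtw p X :: v)) v
  else 0.

Lemma pick_sum_eq G G' w : (forall p Z v, vpar p Z -> G p Z v = G' p Z v) ->
  pick_sum G w = pick_sum G' w.
Proof.
elim: w G G' => //= X w IH G G' GG'; rewrite !GG'; try exact: part_par.
by congr (_ + _); apply: IH => p Z v hZ; apply: GG'.
Qed.

Lemma pick_sumD G G' w :
  pick_sum (fun p Z v => G p Z v + G' p Z v) w = pick_sum G w + pick_sum G' w.
Proof.
elim: w G G' => [|X w IH] G G' /=; first by rewrite addr0.
by rewrite (IH (fun p Z v => G p Z (_ :: v))) [T in T + _ = _]addrACA [LHS]addrACA.
Qed.

Lemma pick_sum_morph (phi : V -> V) G w : phi 0 = 0 -> {morph phi : x y / x + y} ->
  pick_sum (fun p Z v => phi (G p Z v)) w = phi (pick_sum G w).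
Proof.
move=> phi0 phiD; elim: w G => [|X w IH] G //=.
by rewrite !phiD (IH (fun p Z v => G p Z (_ :: v))).
Qed.

Definition pick_additive G := forall p Z Z' v, G p (Z + Z') v = G p Z v + G p Z' v.

Lemma pick_sum_par G p X v : pick_additive G -> vpar p X ->
  pick_sum G (X :: v) = G p X v + pick_sum (fun p Z v => G p Z (vtw p X :: v)) v.
Proof.
move=> GD hX; rewrite /=; congr (_ + _).
have G0 q : G q 0 v = 0 by apply: (addrI (G q 0 v)); rewrite -GD !addr0.
have := part_other hX; have := part_same hX.
by case: p hX => hX -> /= ->; rewrite G0 ?addr0 ?add0r.
Qed.

Lemma pick_sum_additive G : pick_additive G -> (forall p Z, word_additive (G p Z)) ->
  word_additive (pick_sum G).
Proof.
move=> GZ GD u X Y v; elim: u G GZ GD => [|W u IH] G GZ GD /=.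
  rewrite !partD !GZ [T in T + _ = _]addrACA [RHS]addrACA -pick_sumD; congr (_ + _).
  by apply: pick_sum_eq => p Z w _; rewrite twD (GD _ _ [::]).
rewrite !(GD _ _ u) IH => [|p Z Z' w|p Z]; last exact: word_additive_cons.
  by rewrite [T in T + _ = _]addrACA [LHS]addrACA.
exact: GZ.
Qed.

(** Picking one of the two letters X and Y gives the same terms on both sides, in the
   other order. *)
Lemma pick_sum_symmetric G : pick_additive G -> (forall p Z, word_additive (G p Z)) ->
  (forall p Z, vpar p Z -> word_symmetric (G p Z)) -> word_symmetric (pick_sum G).
Proof.
move=> GZ GD GS u p q X Y v hX hY; elim: u G GZ GD GS => [|W u IH] G GZ GD GS.
  have GZ' W : pick_additive (fun p Z v => G p Z (vtw p W :: v)) by move=> *; apply: GZ.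
  rewrite /cat (pick_sum_par _ GZ hX) (pick_sum_par _ GZ hY).
  rewrite (pick_sum_par _ (GZ' X) hY) (pick_sum_par _ (GZ' Y) hX).
  rewrite (tw_par q hX) (tw_par p hY) !(word_additive_osgn _ [::])//.
  rewrite !osgnD !osgn_addb andbC addbb /= addrCA; congr (_ + (_ + _)).
  rewrite -(pick_sum_morph _ _ (osgn0 V _) (@osgnD V _)); apply: pick_sum_eq => r Z w hZ.
  by apply: (GS _ _ hZ [::]); apply: par_tw.
rewrite /= !(GS _ _ (part_par _ _ _) u _ _ _ _ _ hX hY) IH => [|r Z Z' w|r Z|r Z hZ].
- by rewrite -!osgnD.
- exact: GZ.
- exact: word_additive_cons.
- by apply: word_symmetric_cons; apply: GS.
Qed.

(** If the letter f X itself is picked, f comes out of G directly. If another letter is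
   picked, it twists f on its way to the front, and f is twisted back when it comes out of
   G. *)
Lemma pick_sum_scale G f X v : pick_additive G -> (forall p Z, word_additive (G p Z)) ->
  (forall p q g Z v, apar p g -> vpar q Z -> G (p (+) q) (g *: Z) v = g *: G q Z v) ->
  (forall p Z g Y v, vpar p Z -> G p Z (g *: Y :: v) = atw p g *: G p Z (Y :: v)) ->
  pick_sum G (f *: X :: v) = f *: pick_sum G (X :: v).
Proof.
move=> GZ GD Gf Gh.
have FD Y Z : pick_sum G (Y + Z :: v) = pick_sum G (Y :: v) + pick_sum G (Z :: v).
  exact: (pick_sum_additive GZ GD [::]).
elim/(@part_ind _ (gr A)): f => [f g Ef Eg|p f hf].
  by rewrite scalerDl FD Ef Eg -scalerDl.
elim/(@part_ind _ (vgrading A)): X => [X Y EX EY|q X hX].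
  by rewrite scalerDr !FD EX EY -scalerDr.
rewrite (pick_sum_par _ GZ (par_scale hf hX)) (pick_sum_par _ GZ hX) Gf// scalerDr.
congr (_ + _); rewrite -(pick_sum_morph (phi := fun x => f *: x)).
- by apply: pick_sum_eq => r Z w hZ; rewrite tw_scale Gh// twK.
- exact: scaler0.
- exact: scalerDr.
Qed.

End PickSum.
End WordFunctions.

(** * The formal exponential map on words *)

Section ExponentialWords.
Variables (K : fieldType) (A : galg K) (D : connection A).
Local Notation E := (vfield A).
Local Notation apar := (par (gr A)).
Local Notation atw := (tw (gr A)).
Local Notation vpar := (par (vgrading A)).
Local Notation vtw := (tw (vgrading A)).
Implicit Types (F : seq E -> diffop A) (P Q : diffop A).

Lemma diffop_eq P Q : (forall a, (P a : A) = Q a) -> P = Q.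
Proof. by move=> PQ; apply: val_inj; apply: (@funext A A). Qed.

Lemma diffop_vfieldD (X Y : E) : diffop_vfield (X + Y) = diffop_vfield X + diffop_vfield Y.
Proof. exact: diffop_eq. Qed.

Lemma diffop_vfieldZ f (X : E) : diffop_vfield (f *: X) = f *: diffop_vfield X.
Proof. exact: diffop_eq. Qed.

Lemma diffop_scaleMl f P Q : (f *: P) * Q = f *: (P * Q).
Proof. exact: diffop_eq. Qed.

Lemma diffop_vfieldM p (Z : E) f P : vpar p Z ->
  diffop_vfield Z * (f *: P) = (Z f : A) *: P + atw p f *: (diffop_vfield Z * P).
Proof. by move=> hZ; apply: diffop_eq => a; apply: (vfun_Leibniz f (P a) hZ). Qed.

(** The expression between braces in the recursive formula, for a picked letter Z of parity
   p and the word v of the other letters. *)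
Definition pbw_pick F p (Z : E) v := diffop_vfield Z * F v - deriv_word D p Z F v.

(** These are the functions of words that descend to the symmetric algebra. *)
Definition symmetric_multilinear F :=
  [/\ word_additive F, word_symmetric F & word_linear F].

Lemma pbw_pick_additiveZ F : word_additive F -> pick_additive (pbw_pick F).
Proof.
move=> FD p Z Z' v; rewrite /pbw_pick diffop_vfieldD mulrDl (deriv_word_addZ D p Z Z' v FD).
by rewrite opprD addrACA.
Qed.

Lemma pbw_pick_additive F p Z : word_additive F -> word_additive (pbw_pick F p Z).
Proof.
move=> FD u X Y v; rewrite /pbw_pick FD mulrDr (deriv_word_additive D p Z FD).
by rewrite opprD addrACA.
Qed.

Lemma pbw_pick_symmetric F p Z : word_additive F -> word_symmetric F -> vpar p Z ->
  word_symmetric (pbw_pick F p Z).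
Proof.
move=> FD FS hZ u q r X Y v hX hY; rewrite /pbw_pick (FS _ _ _ _ _ _ hX hY).
rewrite (deriv_word_symmetric D hZ FD FS _ _ hX hY) osgnD.
by case: (q && r) => //=; rewrite mulrN.
Qed.

Lemma pbw_pick_scale F p q f Z v : word_linear F -> apar p f ->
  pbw_pick F (p (+) q) (f *: Z) v = f *: pbw_pick F q Z v.
Proof.
move=> FL hf; rewrite /pbw_pick diffop_vfieldZ diffop_scaleMl.
by rewrite (deriv_word_scaleZ D q Z v FL hf) -scalerBr.
Qed.

(** The two derivatives Z(f) of the factor f, one from the composition with Z and the
   other from nabla_Z, cancel. *)
Lemma pbw_pick_head F p Z f X v : word_additive F ->
  (forall f X v, F (f *: X :: v) = f *: F (X :: v)) -> vpar p Z ->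
  pbw_pick F p Z (f *: X :: v) = atw p f *: pbw_pick F p Z (X :: v).
Proof.
move=> FD FZ hZ; rewrite /pbw_pick FZ (diffop_vfieldM _ _ hZ) /= (nabla_scale _ _ _ hZ).
have /= -> := FD [::]; rewrite !FZ.
have -> : deriv_word D p Z (fun w => F (vtw p (f *: X) :: w)) v =
    atw p f *: deriv_word D p Z (fun w => F (vtw p X :: w)) v.
  rewrite -(deriv_word_morph D p Z (phi := fun P => atw p f *: P)).
  - by apply: deriv_word_eq => w; rewrite tw_scale FZ.
  - exact: scaler0.
  - exact: scalerDr.
by rewrite -[T in _ - T]addrA -scalerDr opprD addrACA subrr add0r -scalerBr.
Qed.

Lemma word_linear_front F f X v : word_additive F -> word_linear F ->
  F (f *: X :: v) = f *: F (X :: v).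
Proof.
move=> FD FL; elim/(@part_ind _ (gr A)): f => [f g Ef Eg|p f hf].
  by rewrite !scalerDl -Ef -Eg; apply: (FD [::]).
exact: (FL [::] p).
Qed.

Lemma pick_sum_multilinear F :
  symmetric_multilinear F -> symmetric_multilinear (pick_sum (pbw_pick F)).
Proof.
move=> [FD FS FL]; have GZ := pbw_pick_additiveZ FD.
have GD p Z := @pbw_pick_additive F p Z FD.
have GS p Z := @pbw_pick_symmetric F p Z FD FS.
have HD : word_additive (pick_sum (pbw_pick F)) by exact: pick_sum_additive.
have HS : word_symmetric (pick_sum (pbw_pick F)) by exact: pick_sum_symmetric.
split=> //; apply: word_linear_head => // f X v; apply: pick_sum_scale => //.
  by move=> p q g Z w hg _; apply: pbw_pick_scale.
move=> p Z g Y w hZ; apply: pbw_pick_head => // h W t; exact: word_linear_front.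
Qed.

Lemma scal_multilinear c F :
  symmetric_multilinear F -> symmetric_multilinear (fun w => scal A c *: F w).
Proof.
move=> [FD FS FL]; split=> [u X Y v|u p q X Y v hX hY|u p f X v hf].
- by rewrite FD scalerDr.
- by rewrite (FS _ _ _ _ _ _ hX hY) osgnZ.
- by rewrite (FL _ _ _ _ _ hf) !scalerA scalC.
Qed.

(** pbw on the words of length n; it is zero on all other words, which saves any
   condition of length in the recursion. *)
Fixpoint pbw_word n : seq E -> diffop A :=
  if n is m.+1 then fun w => scal A (n%:R^-1) *: pick_sum (pbw_pick (pbw_word m)) w
  else fun w => if w is [::] then 1 else 0.

Lemma pbw_word_multilinear n : symmetric_multilinear (pbw_word n).
Proof.
elim: n => [|n IH]; last exact: scal_multilinear (pick_sum_multilinear IH).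
split=> [u X Y v|u p q X Y v _ _|u p f X v _]; case: u => [|? ?] /=;
  by rewrite ?addr0 ?osgn0 ?scaler0.
Qed.

Lemma pbw_word1 X : pbw_word 1 [:: X] = diffop_vfield X.
Proof.
rewrite /= invr1 rmorph1 scale1r /pbw_pick /= !subr0 !mulr1 addr0.
by rewrite -diffop_vfieldD part_sum.
Qed.

End ExponentialWords.

(** * Words indexed by ordinals *)

Section HomogeneousWords.
Variables (K : fieldType) (A : galg K) (V : lmodType A).
Local Notation E := (vfield A).

Definition word n (X : 'I_n -> E) : seq E := [seq X i | i <- enum 'I_n].

Lemma wordS n (X : 'I_n.+1 -> E) :
  word X = X ord0 :: word (fun i => X (lift ord0 i)).
Proof. by rewrite /word enum_ordSl /= -map_comp. Qed.

Lemma word0 (X : 'I_0 -> E) : word X = [::].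
Proof. by rewrite /word enum_ord0. Qed.

Lemma sum_degS n (d : 'I_n.+1 -> int) (i : 'I_n) :
  \sum_(j < n.+1 | (j < lift ord0 i)%N) d j
  = d ord0 + \sum_(j < n | (j < i)%N) d (lift ord0 j).
Proof. by rewrite big_mkcond big_ord_recl /= -big_mkcond. Qed.

Lemma word_lift0 n (X : 'I_n.+1 -> E) (i : 'I_n) :
  word (fun j => X (lift (lift ord0 i) j))
  = X ord0 :: word (fun j : 'I_n.-1 => X (lift ord0 (lift i j))).
Proof.
case: n X i => [|n] X i; first by case: i.
rewrite wordS; congr (X _ :: _); first exact: val_inj.
apply: eq_map => j; congr X; apply: val_inj => /=; rewrite /bump /=; lia.
Qed.

(** For homogeneous letters only one parity of each letter contributes, and the twists of
   the letters on its left multiply to the sign of the recursive formula. *)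
Lemma pick_sum_word n (d : 'I_n -> int) (X : 'I_n -> E) (G : bool -> E -> seq E -> V) :
  pick_additive G -> (forall p Z, word_additive (G p Z)) -> (forall i, vdeg (d i) (X i)) ->
  pick_sum G (word X) = \sum_(i < n) osgn (parity (d i * \sum_(j < n | (j < i)%N) d j))
    (G (parity (d i)) (X i) (word (fun j => X (lift i j)))).
Proof.
elim: n d X G => [|n IH] d X G GZ GD hX; first by rewrite word0 big_ord0.
have hX' i : par (vgrading A) (parity (d i)) (X i)
  by exact: (@par_homog _ (vgrading A)) (hX i).
rewrite wordS (pick_sum_par _ GZ (hX' ord0)) big_ord_recl big_pred0// mulr0 /=.
congr (_ + _); rewrite (IH (fun i => d (lift ord0 i))) => [|p Z Z' v|p Z|i].
- apply: eq_bigr => i _; rewrite word_lift0 sum_degS mulrDr parityD addbC -osgn_addb.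
  by rewrite (tw_par _ (hX' ord0)) (word_additive_osgn _ [::] _ _ (GD _ _)) !parityM.
- exact: GZ.
- exact: word_additive_cons.
- exact: hX.
Qed.

Lemma deriv_word_word D p Z n (e : 'I_n -> int) (Y : 'I_n -> E) (F : seq E -> V) :
  word_additive F -> (forall i, vdeg (e i) (Y i)) ->
  deriv_word D p Z F (word Y)
  = \sum_(k < n) osgn (p && parity (\sum_(j < n | (j < k)%N) e j))
      (F (word (fun j => if j == k then D Z (Y k) else Y j))).
Proof.
elim: n e Y F => [|n IH] e Y F FD hY; first by rewrite word0 big_ord0.
rewrite wordS big_ord_recl big_pred0// -[parity 0]/false andbF /=.
congr (_ + _); first by rewrite wordS.
rewrite (IH (fun i => e (lift ord0 i)) _ _ (word_additive_cons _ FD)) => [|i]; last exact: hY.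
apply: eq_bigr => k _; rewrite wordS /= sum_degS parityD andb_addr addbC -osgn_addb.
rewrite (tw_par _ (par_homog (hY ord0 : vgrading A _ _))).
by rewrite (word_additive_osgn _ [::] _ _ FD).
Qed.

End HomogeneousWords.

(** * The formal exponential map *)

Section Exponential.
Variables (K : fieldType) (A : galg K) (D : connection A).
Local Notation E := (vfield A).
Local Notation V := (diffop A).

Definition formal_exponential (pbw : sym A -> V) : Prop :=
  [/\ forall f s t, pbw (f *: s + t) = f *: pbw s + pbw t,
      forall f, pbw (sym_fun f) = diffop_fun f,
      forall X, pbw (sprod (fun _ : 'I_1 => X)) = diffop_vfield X &
      forall (n : nat) (d : 'I_n.+1 -> int) (X : 'I_n.+1 -> E),
        (1 <= n)%N -> (forall i, vdeg (d i) (X i)) ->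
        pbw (sprod X) = scal A (n.+1%:R^-1) *:
          \sum_(i < n.+1) sgn A (d i * \sum_(j < n.+1 | (j < i)%N) d j) *:
            (diffop_vfield (X i) * pbw (sprod (fun j => X (lift i j)))
             - pbw (nabla_sprod D (d i) (X i) (fun j => d (lift i j))
                      (fun j => X (lift i j))))].

Lemma word_deg_twist d p (u v : seq E) (F : seq E -> V) : word_additive F ->
  word_deg d u -> F (map (tw (vgrading A) p) u ++ v) = osgn (parity d && p) (F (u ++ v)).
Proof.
elim: u d F => [|X u IH] d F FD /=; first by move=> ->.
case=> e hX hu; rewrite (IH _ _ (word_additive_cons _ FD) hu).
rewrite (tw_par _ (par_homog (hX : vgrading A e X))) (word_additive_osgn _ [::] _ _ FD).
by rewrite osgn_addb [p && _]andbC -andb_addl -parityD subrK.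
Qed.

Definition pbw_sterm (s : sterm A) : V :=
  \sum_(t <- s) t.1 *: pbw_word D (size t.2) t.2.

(** The relations that define the symmetric algebra preserve the length of words, so that
   each of them concerns a single function [pbw_word n]. *)
Lemma pbw_sterm_rel s t : sym_rel s t -> pbw_sterm s = pbw_sterm t.
Proof.
rewrite /pbw_sterm; elim=> {s t} [//|//|s t u _ -> //|s s' t t' _ E1 _ E2|s t|w|f g w
  |f u X Y v|f u d g e X v hu hg|f u X d Y e v hX hY];
  rewrite ?big_cat ?big_cons ?big_nil ?addr0 /= ?size_cat /=.
- by rewrite E1 E2.
- by rewrite addrC.
- by rewrite scale0r.
- by rewrite scalerDl.
- by have [-> _ _] := pbw_word_multilinear D (size u + (size v).+1); rewrite scalerDr.
- have [FD _ FL] := pbw_word_multilinear D (size u + (size v).+1).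
  rewrite (FL _ _ _ _ _ (par_homog hg)) (word_deg_twist _ _ FD hu) !osgnZ scalerA.
  by rewrite -parityM -sgnZE scalerA.
- have [_ FS _] := pbw_word_multilinear D (size u + (size v).+2).
  rewrite (FS _ _ _ _ _ _ (par_homog (hX : vgrading A d X)) (par_homog (hY : vgrading A e Y))).
  by rewrite -parityM osgnZ -sgnZE scalerA.
Qed.

Definition pbw (x : sym A) : V := pbw_sterm (repr x).

Lemma pbwE s : pbw (\pi_(sym A) s) = pbw_sterm s.
Proof. by apply: pbw_sterm_rel; apply: repr_rel. Qed.

Lemma sym_scaleE f s : f *: \pi_(sym A) s = \pi_(sym A) (sterm_scale f s).
Proof. exact: sym_mulfE. Qed.

Lemma sym_addE s t : \pi_(sym A) s + \pi_(sym A) t = \pi_(sym A) (s ++ t).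
Proof. exact: sym_plusE. Qed.

Lemma pbw_linear f s t : pbw (f *: s + t) = f *: pbw s + pbw t.
Proof.
rewrite -[s]reprK -[t]reprK sym_scaleE sym_addE !pbwE /pbw_sterm big_cat big_map.
by rewrite scaler_sumr; congr (_ + _); apply: eq_bigr => i _; rewrite scalerA.
Qed.

Section LinearMaps.
Variable (h : sym A -> V).
Hypothesis hL : forall f s t, h (f *: s + t) = f *: h s + h t.

Lemma linear_map0 : h 0 = 0.
Proof. by apply: (addrI (h 0)); have := hL 1 0 0; rewrite !scale1r !addr0. Qed.

Lemma linear_map_sum n (c : 'I_n -> A) (s : 'I_n -> sym A) :
  h (\sum_(k < n) c k *: s k) = \sum_(k < n) c k *: h (s k).
Proof.
elim: n c s => [|n IH] c s; first by rewrite !big_ord0 linear_map0.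
by rewrite !big_ord_recl hL IH.
Qed.
End LinearMaps.

Lemma pbw_sprod n (X : 'I_n -> E) : pbw (sprod X) = pbw_word D n (word X).
Proof. by rewrite pbwE /pbw_sterm big_seq1 scale1r /= size_map size_enum_ord. Qed.

Lemma pbw_nabla d Z n (e : 'I_n -> int) (Y : 'I_n -> E) : (forall i, vdeg (e i) (Y i)) ->
  pbw (nabla_sprod D d Z e Y) = deriv_word D (parity d) Z (pbw_word D n) (word Y).
Proof.
move=> hY; have [FD _ _] := pbw_word_multilinear D n.
rewrite (deriv_word_word D _ Z FD hY) (linear_map_sum pbw_linear).
by apply: eq_bigr => k _; rewrite sgnZE parityM pbw_sprod.
Qed.

Lemma pbw_formal_exponential : formal_exponential pbw.
Proof.
split=> [|f|X|n d X _ hX]; first exact: pbw_linear.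
- rewrite /sym_fun sym_scaleE pbwE /pbw_sterm /= big_seq1 mulr1.
  by apply: diffop_eq => a; rewrite -[RHS]/(f * a) -[LHS]/(f * (1 * a)) mul1r.
- by rewrite pbw_sprod wordS word0 pbw_word1.
have [FD _ _] := pbw_word_multilinear D n.
rewrite pbw_sprod [LHS]/= (pick_sum_word _ _ hX).
- congr (_ *: _); apply: eq_bigr => i _; rewrite sgnZE pbw_nabla ?pbw_sprod//.
- exact: pbw_pick_additiveZ.
- by move=> p Z; apply: pbw_pick_additive.
Qed.

(** A word is expanded letter by letter into words of homogeneous letters. *)
Lemma sym_ind (P : sym A -> Prop) : P 0 ->
  (forall f s t, P s -> P t -> P (f *: s + t)) ->
  (forall n (d : 'I_n -> int) X, (forall i, vdeg (d i) (X i)) -> P (sprod X)) ->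
  forall s, P s.
Proof.
move=> P0 PL Pprod s; rewrite -[s]reprK.
have PD x y : P x -> P y -> P (x + y) by move=> hx; rewrite -[x]scale1r; apply: PL.
elim: (repr s) => [//|[f w] r IH].
have -> : \pi_(sym A) ((f, w) :: r) = f *: \pi_(sym A) [:: (1, w)] + \pi_(sym A) r.
  by rewrite sym_scaleE sym_addE /= mulr1.
apply: PL IH; rewrite -[w]cat0s.
have : {in [::], forall X : E, exists d, vdeg d X} by [].
elim: w [::] => [|X w IH] u hu.
  rewrite cats0; have hd (i : 'I_(size u)) : exists d, vdeg d (nth 0 u i).
    by apply: hu; apply: mem_nth.
  have [d hd'] := choice hd; have := Pprod _ d _ hd'; rewrite /sprod.
  by rewrite (map_comp (nth 0 u) val) val_enum_ord map_nth_iota0 ?take_size.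
have piD Y Z : \pi_(sym A) [:: (1, u ++ (Y + Z) :: w)]
    = \pi_(sym A) [:: (1, u ++ Y :: w)] + \pi_(sym A) [:: (1, u ++ Z :: w)].
  by rewrite sym_addE; apply/sym_eqP; apply: sym_add.
elim/(@homog_ind _ (vgrading A)): X => [|Y Z hY hZ|d X hX].
- suff -> : \pi_(sym A) [:: (1, u ++ 0 :: w)] = 0 by [].
  by apply: (addrI (\pi_(sym A) [:: (1, u ++ 0 :: w)])); rewrite -piD !addr0.
- by rewrite piD; apply: PD.
rewrite -cat_rcons; apply: IH => Y; rewrite mem_rcons inE => /predU1P[->|/hu//].
by exists d.
Qed.

(** The recursive formula expresses the value at a product of n+1 homogeneous factors by
   values at products of n factors, which are again homogeneous as nabla has degree 0. *)
Lemma formal_exponential_unique h h' :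
  formal_exponential h -> formal_exponential h' -> h = h'.
Proof.
move=> [hL h0 h1 hS] [hL' h0' h1' hS'].
suff E n : forall (d : 'I_n -> int) X, (forall i, vdeg (d i) (X i)) ->
    h (sprod X) = h' (sprod X).
  apply: funext; apply: sym_ind => [|f s t Es Et|n d X hX]; last exact: E hX.
    by rewrite !linear_map0.
  by rewrite hL hL' Es Et.
elim: n => [|[|n] IH] d X hX.
- have -> : sprod X = sym_fun 1 by rewrite /sym_fun scale1r /sprod (word0 X : map _ _ = _).
  by rewrite h0 h0'.
- have -> : X = fun=> X ord0 by apply: funext => i; rewrite ord1.
  by rewrite h1 h1'.
rewrite (hS _ d)// (hS' _ d)//; congr (_ *: _); apply: eq_bigr => i _.
have hXi j : vdeg (d (lift i j)) (X (lift i j)) by apply: hX.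
rewrite (IH _ _ hXi) !linear_map_sum//; congr (_ *: (_ - _)); apply: eq_bigr => k _.
congr (_ *: _).
apply: (IH (fun j => if j == k then d i + d (lift i k) else d (lift i j))) => j.
by case: eqP => _ //; apply: nabla_deg.
Qed.

Theorem formal_exponential_exists_unique : exists! h, formal_exponential h.
Proof.
exists pbw; split; first exact: pbw_formal_exponential.
by move=> h; apply: formal_exponential_unique pbw_formal_exponential.
Qed.

End Exponential.

Theorem lemma2p2 (R : realType) (k : ground) (M : graded_manifold R k)
    (D : connection (Cinfty M)) :
  exists! pbw : sym (Cinfty M) -> diffop (Cinfty M),
    [/\ forall (f : Cinfty M) (s t : sym (Cinfty M)), pbw (f *: s + t) = f *: pbw s + pbw t,
        forall f : Cinfty M, pbw (sym_fun f) = diffop_fun f,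
        forall X : vfield (Cinfty M), pbw (sprod (fun _ : 'I_1 => X)) = diffop_vfield X &
        forall (n : nat) (d : 'I_n.+1 -> int) (X : 'I_n.+1 -> vfield (Cinfty M)),
          (1 <= n)%N -> (forall i, vdeg (d i) (X i)) ->
          pbw (sprod X) =
            scal (Cinfty M) (n.+1%:R^-1) *:
            \sum_(i < n.+1) sgn (Cinfty M) (d i * \sum_(j < n.+1 | (j < i)%N) d j) *:
              (diffop_vfield (X i) * pbw (sprod (fun j => X (lift i j)))
               - pbw (nabla_sprod D (d i) (X i) (fun j => d (lift i j))
                        (fun j => X (lift i j))))].
Proof. exact: formal_exponential_exists_unique. Qed.
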